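(* Assume that the standard interpretation $\mathfrak{M}$ of first-order arithmetic $S$ is a model of $S$. Then for every natural number $y$: $$y \in T_s\ \text{ if and only if }\ \vDash_{\mathfrak{M}} (\exists x_2)\, Pf(x_2,\overline{y}),$$ where $T_s$ is the class of Gödel numbers of theorems of $S$ and $Pf(x,y)$ is the $S$-formula expressing the arithmetized proof relation of $S$ in $S$.
   Context: $S$ is first-order number theory (first-order Peano arithmetic) as in Mendelson's textbook: the classical first-order theory in the language with equality, $0$, successor, $+$, $\cdot$, whose proper axioms are the usual equality, successor, addition and multiplication axioms together with the first-order induction axiom schema. A fixed standard arithmetization (Gödel numbering) of the syntax of $S$ is used. For a natural number $y$, $\overline{y}$ is the $S$-numeral for $y$. $\vdash_S \mathcal{B}$ means that there exists an $S$-proof of the formula $\mathcal{B}$; $T_s$ is the class of Gödel numbers of formulas $\mathcal{B}$ with $\vdash_S \mathcal{B}$. $\mathfrak{M}$ is the standard interpretation of $S$ (domain the natural numbers, with the usual zero, successor, addition, multiplication and equality), and $\vDash_{\mathfrak{M}} \mathcal{B}$ means that $\mathcal{B}$ is true under $\mathfrak{M}$ in Tarski's sense. $\mathrm{Pf}(x,y)$ is the recursive relation on natural numbers that holds if and only if $x$ is the Gödel number of an $S$-proof of the $S$-formula with Gödel number $y$. $Pf(x,y)$ is a fixed $S$-formula with two free variables that expresses $\mathrm{Pf}$ in $S$: for all natural numbers $x,y$, if $\mathrm{Pf}(x,y)$ holds then $\vdash_S Pf(\overline{x},\overline{y})$, and if $\mathrm{Pf}(x,y)$ does not hold then $\vdash_S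 \lnot Pf(\overline{x},\overline{y})$. *)

(* Defs.v *)
From HB Require Import structures.
From mathcomp Require Import all_boot.

Set Implicit Arguments.
Unset Strict Implicit.
Unset Printing Implicit Defensive.

(** Conventions follow Mendelson, Introduction to Mathematical Logic:
    ~, => and forall are primitive, variables are named, and substitution
    replaces free occurrences without renaming bound variables.  Mendelson's
    variables are x_1, x_2, ...; [Var k] is x_{k+1}. *)

Inductive term : Type :=
| Var of nat
| Zero
| Succ of term
| Add of term & term
| Mul of term & term.

Inductive formula : Type :=
| Eq of term & term
| Neg of formula
| Imp of formula & formula
| All of nat & formula.

Lemma term_comparable : comparable term.
Proof. by move=> s t; rewrite /decidable; decide equality; apply: eq_comparable. Qed.
HB.instance Definition _ := hasDecEq.Build term (compareP term_comparable).

Lemma formula_comparable : comparable formula.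
Proof. by move=> A B; rewrite /decidable; decide equality; apply: eq_comparable. Qed.
HB.instance Definition _ := hasDecEq.Build formula (compareP formula_comparable).

Definition Ex (x : nat) (A : formula) : formula := Neg (All x (Neg A)).

Definition x1 : nat := 0.
Definition x2 : nat := 1.
Definition x3 : nat := 2.

Definition numeral (n : nat) : term := iter n Succ Zero.

Fixpoint tvars (t : term) : seq nat :=
  match t with
  | Var x => [:: x]
  | Zero => [::]
  | Succ t => tvars t
  | Add s t | Mul s t => tvars s ++ tvars t
  end.

Fixpoint fvars (A : formula) : seq nat :=
  match A with
  | Eq s t => tvars s ++ tvars t
  | Neg A => fvars A
  | Imp A B => fvars A ++ fvars B
  | All x A => [seq y <- fvars A | y != x]
  end.

Fixpoint tsubst (f : nat -> term) (t : term) : term :=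
  match t with
  | Var x => f x
  | Zero => Zero
  | Succ t => Succ (tsubst f t)
  | Add s t => Add (tsubst f s) (tsubst f t)
  | Mul s t => Mul (tsubst f s) (tsubst f t)
  end.

Fixpoint fsubst (f : nat -> term) (A : formula) : formula :=
  match A with
  | Eq s t => Eq (tsubst f s) (tsubst f t)
  | Neg A => Neg (fsubst f A)
  | Imp A B => Imp (fsubst f A) (fsubst f B)
  | All x A => All x (fsubst [eta f with x |-> Var x] A)
  end.

Definition subst1 (A : formula) (x : nat) (t : term) : formula :=
  fsubst [eta Var with x |-> t] A.

(** A(s, t), for A with designated variables u and v: simultaneous. *)
Definition subst2 (A : formula) (u v : nat) (s t : term) : formula :=
  fsubst [eta Var with u |-> s, v |-> t] A.

(** No free occurrence of x in A lies in the scope of a quantifier binding a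
    variable of t. *)
Fixpoint free_for (t : term) (x : nat) (A : formula) : bool :=
  match A with
  | Eq _ _ => true
  | Neg A => free_for t x A
  | Imp A B => free_for t x A && free_for t x B
  | All y A => (x \notin fvars (All y A)) || (y \notin tvars t) && free_for t x A
  end.

Inductive logical_axiom : formula -> Prop :=
| A1 B C : logical_axiom (Imp B (Imp C B))
| A2 B C D :
    logical_axiom (Imp (Imp B (Imp C D)) (Imp (Imp B C) (Imp B D)))
| A3 B C :
    logical_axiom (Imp (Imp (Neg C) (Neg B)) (Imp (Imp (Neg C) B) C))
| A4 B x t of free_for t x B :
    logical_axiom (Imp (All x B) (subst1 B x t))
| A5 B C x of x \notin fvars B :
    logical_axiom (Imp (All x (Imp B C)) (Imp B (All x C))).

Inductive proper_axiom : formula -> Prop :=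
| S1 : proper_axiom (Imp (Eq (Var x1) (Var x2))
         (Imp (Eq (Var x1) (Var x3)) (Eq (Var x2) (Var x3))))
| S2 : proper_axiom (Imp (Eq (Var x1) (Var x2))
         (Eq (Succ (Var x1)) (Succ (Var x2))))
| S3 : proper_axiom (Neg (Eq Zero (Succ (Var x1))))
| S4 : proper_axiom (Imp (Eq (Succ (Var x1)) (Succ (Var x2)))
         (Eq (Var x1) (Var x2)))
| S5 : proper_axiom (Eq (Add (Var x1) Zero) (Var x1))
| S6 : proper_axiom (Eq (Add (Var x1) (Succ (Var x2)))
         (Succ (Add (Var x1) (Var x2))))
| S7 : proper_axiom (Eq (Mul (Var x1) Zero) Zero)
| S8 : proper_axiom (Eq (Mul (Var x1) (Succ (Var x2)))
         (Add (Mul (Var x1) (Var x2)) (Var x1)))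
| S9 B x : proper_axiom
    (Imp (subst1 B x Zero)
      (Imp (All x (Imp B (subst1 B x (Succ (Var x))))) (All x B))).

Definition is_axiom (A : formula) : Prop := logical_axiom A \/ proper_axiom A.

(** Axiom, modus ponens or generalization. *)
Definition justified (D : seq formula) (A : formula) : Prop :=
  [\/ is_axiom A,
      exists2 B, B \in D & Imp B A \in D
    | exists x, exists2 B, B \in D & A = All x B].

Definition derivation (D : seq formula) : Prop :=
  forall D1 A D2, D = D1 ++ A :: D2 -> justified D1 A.

Definition proof_of (D : seq formula) (A : formula) : Prop :=
  derivation D /\ exists D', D = rcons D' A.

Definition provable (A : formula) : Prop := exists D, proof_of D A.

(** Mendelson's numbering of symbols, specialized to the language of S:
    0 is a_1, successor f^1_1, + f^2_1, . f^2_2 and = A^2_1, where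
    g(x_k) = 13 + 8k, g(a_k) = 7 + 8k, g(f^n_k) = 1 + 8(2^n 3^k) and
    g(A^n_k) = 3 + 8(2^n 3^k). *)
Definition g_lpar := 3.
Definition g_rpar := 5.
Definition g_comma := 7.
Definition g_neg := 9.
Definition g_imp := 11.
Definition g_all := 13.
Definition g_var (k : nat) := 13 + 8 * k.+1.
Definition g_zero := 7 + 8 * 1.
Definition g_succ := 1 + 8 * (2 ^ 1 * 3 ^ 1).
Definition g_add := 1 + 8 * (2 ^ 2 * 3 ^ 1).
Definition g_mul := 1 + 8 * (2 ^ 2 * 3 ^ 2).
Definition g_eq := 3 + 8 * (2 ^ 2 * 3 ^ 1).

(** Symbol codes of the official strings: f(t), f(s,t), A(s,t), (~B), (B=>C)
    and ((forall x)B). *)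
Fixpoint tcodes (t : term) : seq nat :=
  match t with
  | Var x => [:: g_var x]
  | Zero => [:: g_zero]
  | Succ t => [:: g_succ; g_lpar] ++ tcodes t ++ [:: g_rpar]
  | Add s t =>
      [:: g_add; g_lpar] ++ tcodes s ++ [:: g_comma] ++ tcodes t ++ [:: g_rpar]
  | Mul s t =>
      [:: g_mul; g_lpar] ++ tcodes s ++ [:: g_comma] ++ tcodes t ++ [:: g_rpar]
  end.

Fixpoint fcodes (A : formula) : seq nat :=
  match A with
  | Eq s t =>
      [:: g_eq; g_lpar] ++ tcodes s ++ [:: g_comma] ++ tcodes t ++ [:: g_rpar]
  | Neg A => [:: g_lpar; g_neg] ++ fcodes A ++ [:: g_rpar]
  | Imp A B => [:: g_lpar] ++ fcodes A ++ [:: g_imp] ++ fcodes B ++ [:: g_rpar]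
  | All x A =>
      [:: g_lpar; g_lpar; g_all; g_var x; g_rpar] ++ fcodes A ++ [:: g_rpar]
  end.

Lemma ex_next_prime (n : nat) : exists p, (n < p) && prime p.
Proof. by have [p np pp] := prime_above n; exists p; rewrite np. Qed.

(** p_0 = 2, p_1 = 3, p_2 = 5, ... *)
Fixpoint nth_prime (i : nat) : nat :=
  if i is j.+1 then ex_minn (ex_next_prime (nth_prime j)) else 2.

Definition seq_code (s : seq nat) : nat :=
  \prod_(i < size s) nth_prime i ^ nth 0 s i.

Definition gn (A : formula) : nat := seq_code (fcodes A).

Definition gn_seq (D : seq formula) : nat := seq_code (map gn D).

Definition Pf (x y : nat) : Prop :=
  exists D A, [/\ gn_seq D = x, gn A = y & proof_of D A].

Definition T_s (y : nat) : Prop := exists2 A, gn A = y & provable A.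

(** F, with the free variables u and v in this order, expresses R in S. *)
Definition expresses (R : nat -> nat -> Prop) (F : formula) (u v : nat) : Prop :=
  [/\ u != v,
      fvars F =i [:: u; v],
      forall x y, R x y -> provable (subst2 F u v (numeral x) (numeral y))
    & forall x y, ~ R x y ->
        provable (Neg (subst2 F u v (numeral x) (numeral y)))].

Record interpretation : Type := Interpretation {
  dom :> Type;
  i_zero : dom;
  i_succ : dom -> dom;
  i_add : dom -> dom -> dom;
  i_mul : dom -> dom -> dom;
  i_eq : dom -> dom -> Prop }.

Fixpoint term_val (M : interpretation) (e : nat -> M) (t : term) : M :=
  match t with
  | Var x => e x
  | Zero => i_zero M
  | Succ t => i_succ (term_val e t)
  | Add s t => i_add (term_val e s) (term_val e t)
  | Mul s t => i_mul (term_val e s) (term_val e t)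
  end.

Fixpoint sat (M : interpretation) (e : nat -> M) (A : formula) : Prop :=
  match A with
  | Eq s t => i_eq (term_val e s) (term_val e t)
  | Neg A => ~ sat e A
  | Imp A B => sat e A -> sat e B
  | All x A => forall d : M, sat [eta e with x |-> d] A
  end.

Definition true_in (M : interpretation) (A : formula) : Prop :=
  forall e : nat -> M, sat e A.

Definition is_model (M : interpretation) : Prop :=
  forall A, is_axiom A -> true_in M A.

Definition standard : interpretation :=
  @Interpretation nat 0 S addn muln (fun m n => m = n).

(* Main.v *)
Require Import Defs.
From mathcomp Require Import all_boot.
From Stdlib Require Import Classical.

(** The theorem combines soundness with the fact that Pf is decided by the
    theory on numerals.  In a model every provable formula is true
    ([provable_true]), so each proved instance of F or of its negation is true
    in the standard interpretation.  As F expresses Pf, the numbers d such that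
    F(d, y) is true are then exactly the d with Pf(d, y): if Pf(d, y) failed,
    the negation of F(d, y) would be provable, hence true.  Existence of such
    a d is what provability of the formula numbered y means.

    What remains is to pass between the open instance F(x_2, y), evaluated at
    an assignment sending x_2 to d, and the closed instance F(d, y).  Both mean
    that F holds once u is assigned d and v is assigned y, by the
    substitution lemma [sat_fsubst]; capture is excluded because x_2 is free
    for u in F, and because numerals have no variables. *)

Set Implicit Arguments.
Unset Strict Implicit.
Unset Printing Implicit Defensive.

Lemma free_for_closed t x A : tvars t = [::] -> free_for t x A.
Proof.
move=> t0; elim: A => //= [B -> C -> //|y A ->].
by rewrite t0 orbT.
Qed.

(** A variable cannot be captured by its own quantifier: under that quantifier
    it has no free occurrence left to replace. *)
Lemma free_for_self x A : free_for (Var x) x A.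
Proof.
elim: A => //= [B -> C -> //|y A ->].
by rewrite andbT inE mem_filter; case: (eqVneq x y) => //=; rewrite orbT.
Qed.

Lemma tvars_numeral n : tvars (numeral n) = [::].
Proof. by elim: n. Qed.

Lemma term_val_numeral (e : nat -> standard) n : term_val e (numeral n) = n.
Proof. by elim: n => //= n ->. Qed.

Section Satisfaction.

Variable M : interpretation.
Implicit Types (e : nat -> M) (A : formula).

Lemma eq_term_val e e' t :
  {in tvars t, e =1 e'} -> term_val e t = term_val e' t.
Proof.
elim: t => //= [x|t IH|s IHs t IHt|s IHs t IHt] ee'.
- by apply: ee'; rewrite inE.
- by rewrite IH.
- by rewrite IHs ?IHt // => x xt; apply: ee'; rewrite mem_cat xt ?orbT.
- by rewrite IHs ?IHt // => x xt; apply: ee'; rewrite mem_cat xt ?orbT.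
Qed.

Lemma eq_sat e e' A : {in fvars A, e =1 e'} -> sat e A <-> sat e' A.
Proof.
elim: A e e' => /= [s t|A IH|A IHA B IHB|x A IH] e e' ee'.
- by rewrite !(@eq_term_val e e') // => x xt; apply: ee';
    rewrite mem_cat xt ?orbT.
- by have := IH _ _ ee'; tauto.
- have /IHA : {in fvars A, e =1 e'}.
    by move=> x xA; apply: ee'; rewrite mem_cat xA.
  have /IHB : {in fvars B, e =1 e'}.
    by move=> x xB; apply: ee'; rewrite mem_cat xB orbT.
  by tauto.
- have eqd d : sat [eta e with x |-> d] A <-> sat [eta e' with x |-> d] A.
    apply: IH => y yA /=; case: (eqVneq y x) => // nyx.
    by apply: ee'; rewrite mem_filter nyx.
  by split=> H d; apply/eqd.
Qed.

Lemma term_val_tsubst e f t :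
  term_val e (tsubst f t) = term_val (fun y => term_val e (f y)) t.
Proof. by elim: t => //= [t ->|s -> t ->|s -> t ->]. Qed.

(** The substitution lemma.  Under a quantifier on x the substitution is reset
    to the identity at x, which stays admissible by [free_for_self]; elsewhere
    admissibility keeps x out of the substituted terms, so their values ignore
    the element chosen for x. *)
Lemma sat_fsubst e f A : {in fvars A, forall y, free_for (f y) y A} ->
  sat e (fsubst f A) <-> sat (fun y => term_val e (f y)) A.
Proof.
elim: A e f => /= [s t|A IH|A IHA B IHB|x A IH] e f ff.
- by rewrite !term_val_tsubst.
- by have := IH e f ff; tauto.
- have /(IHA e) : {in fvars A, forall y, free_for (f y) y A}.
    by move=> y yA; have := ff y; rewrite mem_cat yA => /(_ isT)/andP[].
  have /(IHB e) : {in fvars B, forall y, free_for (f y) y B}.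
    by move=> y yB; have := ff y; rewrite mem_cat yB orbT => /(_ isT)/andP[].
  by tauto.
- have ffA y : y \in fvars A -> y != x ->
      (x \notin tvars (f y)) && free_for (f y) y A.
    move=> yA nyx; have := ff y.
    by rewrite mem_filter nyx yA => /(_ isT).
  have eqd d : sat [eta e with x |-> d] (fsubst [eta f with x |-> Var x] A)
      <-> sat [eta (fun y => term_val e (f y)) with x |-> d] A.
    apply: iff_trans (IH _ _ _) _ => [y yA /=|].
      by case: eqVneq => [->|/(ffA y yA)/andP[]//]; apply: free_for_self.
    apply: eq_sat => y yA /=.
    case: eqVneq => [_|/(ffA y yA)/andP[xf _]] /=; first by rewrite eqxx.
    apply: eq_term_val => z zf /=.
    by case: eqVneq => // zx; rewrite -zx zf in xf.
  by split=> H d; apply/eqd.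
Qed.

Lemma sat_subst2 e A u v s t : free_for s u A -> free_for t v A ->
  sat e (subst2 A u v s t) <->
  sat [eta e with u |-> term_val e s, v |-> term_val e t] A.
Proof.
move=> su tv; apply: iff_trans (sat_fsubst _ _) _ => [y _ /=|].
  case: eqVneq => [->//|_]; case: eqVneq => [->//|_].
  exact: free_for_self.
by apply: eq_sat => y _ /=; do 2![case: ifP => // _].
Qed.

(** Soundness, by induction along the derivation.  Generalization preserves
    truth because truth quantifies over all assignments. *)
Lemma provable_true A : is_model M -> provable A -> true_in M A.
Proof.
move=> modM [D [der [D' defD]]].
suff allD E : derivation E -> forall B, B \in E -> true_in M B.
  by apply: (allD D der); rewrite defD mem_rcons mem_head.
elim/last_ind: E => // E B IH derE C.
have truE : forall C, C \in E -> true_in M C.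
  apply: IH => D1 C' D2 defE; apply: (derE _ _ (rcons D2 B)).
  by rewrite defE rcons_cat.
rewrite mem_rcons inE => /predU1P[->|]; last exact: truE.
have [|[C' /truE C'M /truE CBM] e|[x [C' /truE C'M ->]] e d] :=
  derE E B [::] (esym (cats1 E B)).
- exact: modM.
- exact: CBM (C'M e).
- exact: C'M.
Qed.

End Satisfaction.

(** Links the open formula below the quantifier to the closed instances that
    provability speaks of; it relies on every standard element being the value
    of a numeral. *)
Lemma sat_subst2_numeral (e : nat -> standard) A u v x t :
    free_for (Var x) u A -> free_for t v A ->
  sat e (subst2 A u v (Var x) t) <->
  sat e (subst2 A u v (numeral (e x)) t).
Proof.
move=> xu tv; have nu : free_for (numeral (e x)) u A.
  exact: free_for_closed (tvars_numeral _).
apply: iff_trans (sat_subst2 e xu tv) (iff_sym _).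
by have := sat_subst2 e nu tv; rewrite term_val_numeral.
Qed.

Theorem proposition2p5 (F : formula) (u v : nat)
  (F_expresses_Pf : expresses Pf F u v)
  (x2_free_for_u : free_for (Var x2) u F)
  (standard_model : is_model standard) :
  forall y : nat,
    T_s y <-> true_in standard (Ex x2 (subst2 F u v (Var x2) (numeral y))).
Proof.
move=> y; have [_ _ PfF NPfF] := F_expresses_Pf.
have yv : free_for (numeral y) v F by apply: free_for_closed (tvars_numeral _).
have instance (e : nat -> standard) (d : standard) :
    sat [eta e with x2 |-> d] (subst2 F u v (Var x2) (numeral y)) <->
    sat [eta e with x2 |-> d] (subst2 F u v (numeral d) (numeral y)).
  exact: sat_subst2_numeral.
split=> [[A gnA [D prD]] e /(_ (gn_seq D)) | exF].
  have PfDy : Pf (gn_seq D) y by exists D, A.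
  by apply; apply/instance; apply: provable_true (PfF _ _ PfDy) _.
(* The formula asserts existence only as a negated universal, so no d can be
   extracted from it: the proof goes by contradiction. *)
apply: NNPP => NTy; apply: (exF (fun=> 0)) => d /instance.
have NPf : ~ Pf d y by case=> D [A [_ gnA prD]]; apply: NTy; exists A => //; exists D.
exact: provable_true (NPfF _ _ NPf) _.
Qed.
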